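(* Let $r\ge 2$ and $\ell\in\{2,3,5\}$. If $H$ is any $r$-graph with maximum degree $\Delta$, then as $\Delta\to\infty$, $$\mathrm{ex}\left(H,\{TC^r_{r+1},TC^r_{r+2},\ldots,TC^r_{\ell r}\}\right)\ge \Delta^{-\frac{\ell-1}{\ell(r-1)}-o(1)}\cdot e(H).$$
   Context: An $r$-graph is an $r$-uniform hypergraph. For integers $r<k$, the tight $k$-cycle $TC^r_k$ is the $r$-graph on vertices $u_0,\ldots,u_{k-1}$ with edges $\{u_i,u_{i+1},\ldots,u_{i+r-1}\}$ for $0\le i<k$, indices modulo $k$. For a family $\mathcal{F}$ of $r$-graphs, $\mathrm{ex}(H,\mathcal{F})$ is the maximum number of edges in a subgraph of $H$ containing no member of $\mathcal{F}$ as a subgraph. *)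

(* Defs.v *)
From mathcomp Require Import all_boot.

Set Implicit Arguments.
Unset Strict Implicit.
Unset Printing Implicit Defensive.

Record hypergraph := Hypergraph {
  vertex :> finType;
  edges : {set {set vertex}}
}.

Arguments Hypergraph {vertex} edges.

Definition is_uniform (r : nat) (H : hypergraph) : bool :=
  [forall e in edges H, #|e| == r].

Definition degree (H : hypergraph) (v : H) : nat :=
  #|[set e in edges H | v \in e]|.

Definition max_degree (H : hypergraph) : nat := \max_(v : H) degree v.

(* The embedding is on vertices and not induced: [G] may have further edges
   inside the image of [f]. *)
Definition contains (G F : hypergraph) : bool :=
  [exists f : {ffun F -> G},
    injectiveb f && [forall e in edges F, f @: e \in edges G]].

Definition avoids (G : hypergraph) (Fs : seq hypergraph) : bool :=
  all (fun F => ~~ contains G F) Fs.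

(* Subgraphs of [H] are taken spanning, i.e. given by a set of edges of [H].
   Deleting isolated vertices matters only for forbidden hypergraphs which have
   isolated vertices themselves; tight cycles have none. *)
Definition ex_num (H : hypergraph) (Fs : seq hypergraph) : nat :=
  \max_(E : {set {set H}} | (E \subset edges H) && avoids (Hypergraph E) Fs) #|E|.

Definition cyclic_interval (r k : nat) (i : 'I_k) : {set 'I_k} :=
  [set j : 'I_k | [exists s : 'I_r, j == (i + s) %% k :> nat]].

(* Meaningful for [r < k]; see [tight_cycle_uniform]. *)
Definition tight_cycle (r k : nat) : hypergraph :=
  Hypergraph [set cyclic_interval r i | i : 'I_k].

(* [TC^r_{r+1}, TC^r_{r+2}, ..., TC^r_m] *)
Definition tight_cycles_upto (r m : nat) : seq hypergraph :=
  [seq tight_cycle r k | k <- index_iota r.+1 m.+1].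

Lemma tight_cycle_uniform (r k : nat) : r <= k -> is_uniform r (tight_cycle r k).
Proof.
move=> rk; apply/forall_inP => _ /imsetP[i _ ->].
have k0 : 0 < k by apply: leq_ltn_trans (ltn_ord i).
pose f (s : 'I_r) : 'I_k := Ordinal (ltn_pmod (i + s) k0).
have f_inj : injective f.
  move=> s t /(congr1 val) /= /eqP; rewrite eqn_modDl.
  rewrite !modn_small ?(leq_trans (ltn_ord _)) //.
  by move/eqP/val_inj.
suff -> : cyclic_interval r i = f @: [set: 'I_r].
  by rewrite card_imset // cardsT card_ord.
apply/setP => j; rewrite inE; apply/existsP/imsetP => [[s /eqP js]|[s _ ->]].
  by exists s => //; apply: val_inj.
by exists s.
Qed.

(* Main.v *)
(* Write D for the maximum degree. After a random r-colouring of the vertices all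
   edges are rainbow. If most edges had codegree above a large multiple of
   D^(1/(r-1)) in r-1 colour classes, pruning small fibres would leave a
   subgraph in which every such codegree exceeds D^(1/(r-1)), hence a vertex of
   degree above D. So for two colours i, j a positive fraction of the edges has
   codegrees O(D^(1/(r-1))). Now label the vertices of colours i and j at random
   by the points and lines of a bipartite graph with q^l vertices on each side,
   q^(l+1) edges and no cycle of length at most 2l, where q^l is of order
   D^(1/(r-1)), and keep the edges whose two labels are incident and differ from
   those of the edges sharing the other r-1 vertices. A fraction of order
   q^(1-l) survives, and a tight cycle of length at most lr would yield a closed
   non-backtracking walk of length at most 2l. The bipartite graphs are the
   affine parts of generalized (l+1)-gons over the field with q = 3^k elements;
   powers of 3 are dense enough, and in characteristic 3 the hexagon has
   monomial equations. Only a constant factor is lost, so o(D) = O(1/ln D). *)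

Require Import Defs.
From mathcomp Require Import all_boot all_order all_algebra all_field.
From mathcomp Require Import ring zify.

(** * Counting tools: averaging, random labellings and pruning *)

(** First-moment method with the probability m/n kept in integers: double count the pairs (w, e)
    with [good w e]. If every w fell short, so would the sum. *)
Lemma averaging {W A : finType} (E : {set A}) (good : W -> A -> bool) (m n : nat) :
  0 < #|W| ->
  (forall e, e \in E -> m * #|W| <= n * #|[set w | good w e]|) ->
  exists w, m * #|E| <= n * #|[set e in E | good w e]|.
Proof.
move=> W0 h; apply/existsP; apply: contraT; rewrite negb_exists => /forallP lt.
have dc : \sum_w #|[set e in E | good w e]| = \sum_(e in E) #|[set w | good w e]|.
  transitivity (\sum_w \sum_(e in E) (good w e : nat)).
    apply: eq_bigr => w _; rewrite -sum1_card big_mkcond [RHS]big_mkcond /=.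
    by apply: eq_bigr => e _; rewrite inE; case: (e \in E); case: (good w e).
  rewrite exchange_big /=; apply: eq_bigr => e _.
  rewrite -sum1_card big_mkcond [RHS]big_mkcond /=.
  by apply: eq_bigr => w _; rewrite inE; case: (good w e).
have le : m * #|W| * #|E| <= n * \sum_w #|[set e in E | good w e]|.
  rewrite dc big_distrr /= mulnC -sum_nat_const; exact: leq_sum.
have : n * \sum_w #|[set e in E | good w e]| < #|W| * (m * #|E|).
  rewrite big_distrr /= -sum_nat_const.
  have [w0 _] := card_gt0P W0.
  rewrite (bigD1 w0) //= [X in _ < X](bigD1 w0) //= -addSn leq_add //.
    by rewrite ltnNge lt.
  by apply: leq_sum => w _; rewrite ltnW // ltnNge lt.
by rewrite ltnNge mulnA [#|W| * m]mulnC le.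
Qed.

Lemma card_ffun_family {V T : finType} (F : V -> {set T}) :
  #|[set f : {ffun V -> T} | [forall x, f x \in F x]]| = \prod_x #|F x|.
Proof.
transitivity #|family (fun x => mem (F x))|.
  by apply: eq_card => f; rewrite inE; apply/forallP/familyP.
by rewrite card_family foldrE big_image.
Qed.

Lemma prod_if_card {V : finType} (D : {set V}) (a b : nat) :
  (\prod_x (if x \in D then a else b)) * b ^ #|D| = a ^ #|D| * b ^ #|V|.
Proof.
rewrite (bigID (mem D)) /= (eq_bigr (fun=> a)) => [|x ->] //.
rewrite [X in _ * X * _](eq_bigr (fun=> b)) => [|x /negbTE ->] //.
rewrite !prod_nat_const -mulnA -expnD -(cardC D) addnC.
by congr (_ * _ ^ (_ + _)); apply: eq_card => x; rewrite !inE.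
Qed.

(** Bernoulli's inequality (1 - 1/(n+1))^w >= 1 - w/(n+1) with denominators cleared; truncated
    subtraction makes the left side 0 once w > n. *)
Lemma bernoulli_nat (n w : nat) : n.+1 ^ w * (n.+1 - w) <= n.+1 * n ^ w.
Proof.
elim: w => [|w IH]; first by rewrite subn0 mul1n muln1.
have [wn|nw] := ltnP w n; last by rewrite (_ : _ - _ = 0) ?muln0 //; lia.
have [k nk] : exists k, n = w + k by exists (n - w); rewrite subnKC // ltnW.
have e1 : n.+1 - w = k.+1 by lia.
rewrite (_ : n.+1 - w.+1 = k); last by lia.
move: IH; rewrite e1 !expnS; move: (n.+1 ^ w) (n ^ w) => X Y IH.
apply: leq_trans (_ : n * (X * k.+1) <= _); last by nia.
have h : n.+1 * k <= n * k.+1 by nia.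
by have := leq_mul (leqnn X) h; lia.
Qed.

(* Each of the [#|D|] forbidden coincidences costs a factor [1 - 1/#|T|]. *)
Lemma card_labellings {V T : finType} (v : V) (D : {set V}) (N : {set T}) :
  v \notin D -> 2 * #|D| <= #|T| ->
  #|N| * #|{ffun V -> T}| <=
    2 * #|T| * #|[set f : {ffun V -> T} |
                   (f v \in N) && [forall x in D, f x != f v]]|.
Proof.
move=> vD hD; rewrite card_ffun.
have [->|/card_gt0P[a0 _]] := posnP #|N|; first by [].
have T0 : 0 < #|T| by apply/card_gt0P; exists a0.
(* For a in [N] these sets are disjoint parts of the set to be counted: value a at [v], other values
   on [D]. *)
pose S a := [set f : {ffun V -> T} | [forall x, f x \in
  if x == v then [set a] else if x \in D then ~: [set a] else setT]].
have cS a : #|T| ^ #|V| <= 2 * #|T| * #|S a|.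
  rewrite card_ffun_family (bigD1 v) //= eqxx cards1 mul1n.
  set P := \prod_(_ | _) _.
  have eP : \prod_x (if x \in D then #|T|.-1 else #|T|) = #|T| * P.
    rewrite (bigD1 v) //= (negbTE vD); congr (_ * _); apply: eq_bigr => x xv.
    rewrite (negbTE xv); case: ifP; rewrite ?cardsT // => _.
    by have := cardsC1 a.
  have := prod_if_card D #|T|.-1 #|T|; rewrite {}eP.
  have := bernoulli_nat #|T|.-1 #|D|; rewrite prednK //.
  have X0 : 0 < #|T| ^ #|D| by rewrite expn_gt0 T0.
  move: P X0 hD T0 => P; move: (#|T| ^ #|D|) (#|T|.-1 ^ #|D|) (#|T| ^ #|V|) => X Y Z.
  move: #|T| #|D| => t d X0 hd t0 h1 h2.
  rewrite -(leq_pmul2l X0).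
  have -> : X * (2 * t * P) = 2 * (t * P * X) by lia.
  rewrite h2 mulnA leq_mul2r; apply/orP; right.
  (* Since 2d <= t, tX <= 2X(t - d), and Bernoulli bounds this by 2tY. *)
  rewrite -(leq_pmul2l t0); apply: leq_trans (_ : 2 * (X * (t - d)) <= _); nia.
have : #|N| * #|T| ^ #|V| <= \sum_(a in N) 2 * #|T| * #|S a|.
  by rewrite -sum_nat_const; apply: leq_sum.
rewrite -big_distrr /= => /leq_trans; apply; rewrite leq_mul2l; apply/orP; right.
rewrite -[X in _ <= X]sum1_card (partition_big (fun f : {ffun V -> T} => f v) (mem N)) /=.
  apply: leq_sum => a aN; rewrite -sum1_card [X in X <= _]big_mkcond.
  rewrite [X in _ <= X]big_mkcond /=.
  apply: leq_sum => f _; case: ifP => //; rewrite inE => /forallP h.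
  have fv : f v = a by have := h v; rewrite eqxx inE => /eqP.
  rewrite inE fv aN eqxx andbT /=; case: ifP => // /negP[].
  apply/forall_inP => x xD; have := h x; rewrite xD.
  by case: eqP => [xv|_]; [move: vD; rewrite -xv xD|rewrite !inE].
by move=> f; rewrite inE => /andP[].
Qed.

(* Fibres of size less than [s] are deleted one at a time; each deletion removes a
   point of some image [phi i @: E] at the cost of fewer than [s] elements. *)
Lemma prune_small_fibres {A B K : finType} (phi : K -> A -> B) (I : {set K})
    (s : nat) (E : {set A}) :
  \sum_(i in I) s * #|phi i @: E| < #|E| ->
  exists2 E' : {set A}, E' \subset E /\ E' != set0 &
    forall i e, i \in I -> e \in E' ->
      s <= #|[set e' in E' | phi i e' == phi i e]|.
Proof.
have [n] := ubnP #|E|; elim: n E => // n IH E /ltnSE leEn lt.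
have [/forallP ok|] := boolP [forall i, forall e,
    (i \in I) && (e \in E) ==> (s <= #|[set e' in E | phi i e' == phi i e]|)].
  exists E; first by split=> //; rewrite -card_gt0; apply: leq_ltn_trans lt.
  by move=> i e iI eE; move/forallP/(_ e)/implyP: (ok i); apply; rewrite iI.
rewrite negb_forall => /existsP[i]; rewrite negb_forall => /existsP[e].
rewrite negb_imply -ltnNge => /andP[/andP[iI eE]].
set F := [set _ in _ | _] => ltF.
have FE : F \subset E by apply/subsetP => x; rewrite inE => /andP[].
have eF : e \in F by rewrite inE eE eqxx.
have cE : #|E| = #|E :\: F| + #|F| by rewrite -(cardsID F E) (setIidPr FE) addnC.
have F0 : 0 < #|F| by apply/card_gt0P; exists e.
have [||E' [sE' E'0] hE'] := IH (E :\: F).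
- by apply: leq_trans leEn; rewrite cE -addn1 leq_add2l.
- have : \sum_(j in I) s * #|phi j @: (E :\: F)| + s
      <= \sum_(j in I) s * #|phi j @: E|.
    rewrite (bigD1 i) //= [X in _ <= X](bigD1 i) //= addnAC leq_add //.
      rewrite -mulnSr leq_mul2l; apply/orP; right.
      apply: proper_card; apply/properP; split; first by rewrite imsetS ?subsetDl.
      exists (phi i e); first by rewrite imset_f.
      apply/imsetP => -[x]; rewrite !inE => /andP[+ xE] eq_phi.
      by rewrite xE eq_phi eqxx.
    by apply: leq_sum => j _; rewrite leq_mul2l subset_leq_card ?orbT // imsetS ?subsetDl.
  by move: lt; rewrite cE; lia.
- exists E' => //; split=> //; exact: subset_trans sE' (subsetDl _ _).
Qed.

(** * Coloured hypergraphs *)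

Definition rainbow {V : finType} {r : nat} (c : V -> 'I_r) (e : {set V}) : bool :=
  [forall i, #|[set v in e | c v == i]| == 1].

Definition off {V : finType} {r : nat} (c : V -> 'I_r) (J : {set 'I_r})
    (e : {set V}) : {set V} := [set v in e | c v \notin J].

(** For rainbow edges this is the degree in [E] of the (r-1)-set left when the vertex of colour [i]
    is removed; an edge [e] of [E] counts itself. *)
Definition codegree {V : finType} {r : nat} (c : V -> 'I_r) (E : {set {set V}})
    (i : 'I_r) (e : {set V}) : nat :=
  #|[set e' in E | off c [set i] e' == off c [set i] e]|.

Lemma rainbow_ex {V : finType} {r : nat} {c : V -> 'I_r} {e : {set V}} (i : 'I_r) :
  rainbow c e -> exists2 v, v \in e & c v = i.
Proof.
move/forallP/(_ i)/cards1P => [v hv].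
have : v \in [set v in e | c v == i] by rewrite hv set11.
by rewrite inE => /andP[ve /eqP]; exists v.
Qed.

Lemma rainbow_inj {V : finType} {r : nat} {c : V -> 'I_r} {e : {set V}} {v w : V} :
  rainbow c e -> v \in e -> w \in e -> c v = c w -> v = w.
Proof.
move/forallP/(_ (c w))/cards1P => [u hu] ve we cvw.
have : v \in [set v in e | c v == c w] by rewrite inE ve cvw eqxx.
have : w \in [set v in e | c v == c w] by rewrite inE we eqxx.
by rewrite hu !inE => /eqP-> /eqP->.
Qed.

(** A random colouring makes an edge rainbow with probability r!/r^r. Counting a single bijection
    per edge gives 1/r^r, which suffices. *)
Lemma rainbow_colouring {V : finType} (r : nat) (E : {set {set V}}) :
  0 < r -> (forall e, e \in E -> #|e| = r) ->
  exists c : V -> 'I_r, #|E| <= r ^ r * #|[set e in E | rainbow c e]|.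
Proof.
case: r => // r _ hE.
have [||c] := @averaging {ffun V -> 'I_r.+1} _ E (fun c e => rainbow c e) 1 (r.+1 ^ r.+1).
- by rewrite card_ffun card_ord expn_gt0.
- move=> e eE; rewrite mul1n.
  pose F x : {set 'I_r.+1} := if x \in e then [set inord (index x (enum e))] else setT.
  have sz : size (enum e) = r.+1 by rewrite -cardE hE.
  have cF : r.+1 ^ r.+1 * #|[set f : {ffun V -> 'I_r.+1} | [forall x, f x \in F x]]|
      = #|{ffun V -> 'I_r.+1}|.
    rewrite card_ffun_family card_ffun card_ord mulnC -[X in _ ^ X](hE _ eE).
    rewrite (eq_bigr (fun x => if x \in e then 1 else r.+1)) => [|x _].
      by rewrite prod_if_card exp1n mul1n.
    by rewrite /F; case: ifP; rewrite ?cards1 // cardsT card_ord.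
  rewrite -cF leq_mul2l; apply/orP; right; apply: subset_leq_card.
  apply/subsetP => f; rewrite !inE => /forallP hf; apply/forallP => i.
  have v0 : V by case: (enum e) sz.
  have ni : nth v0 (enum e) i \in e by rewrite -mem_enum mem_nth // sz.
  apply/cards1P; exists (nth v0 (enum e) i); apply/setP => x; rewrite !inE.
  apply/andP/eqP => [[xe /eqP fx]|->].
    have := hf x; rewrite /F xe fx inE => /eqP ->.
    by rewrite inordK ?nth_index ?mem_enum // -sz index_mem mem_enum.
  have := hf (nth v0 (enum e) i); rewrite /F ni inE => /eqP ->; split=> //.
  by rewrite index_uniq ?enum_uniq ?sz // inord_val.
- by rewrite mul1n; exists c.
Qed.

Lemma off_eqP {V : finType} {r : nat} {c : V -> 'I_r} {J : {set 'I_r}} {e e' : {set V}} :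
  off c J e = off c J e' <-> forall v, c v \notin J -> (v \in e) = (v \in e').
Proof.
split=> [/setP h v vJ|h]; first by have := h v; rewrite !inE vJ !andbT.
by apply/setP => v; rewrite !inE; case: (boolP (_ \in J)) => /= vJ; rewrite ?andbF // h.
Qed.

(* Changing the coordinates in [J] one at a time gives at least [s] choices each. *)
Lemma codegree_growth {V : finType} {r : nat} (c : V -> 'I_r) (E : {set {set V}})
    (s : nat) (J : {set 'I_r}) :
  (forall i e, i \in J -> e \in E -> s <= codegree c E i e) ->
  forall e, e \in E -> s ^ #|J| <= #|[set e' in E | off c J e' == off c J e]|.
Proof.
have [n] := ubnP #|J|; elim: n J => // n IH J /ltnSE leJn h e eE.
have [->|/set0Pn[i iJ]] := eqVneq J set0.
  by rewrite cards0 card_gt0; apply/set0Pn; exists e; rewrite inE eE eqxx.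
have cJ : #|J| = #|J :\ i|.+1 by rewrite (cardsD1 i) iJ.
pose N e1 := [set e' in E | off c (J :\ i) e' == off c (J :\ i) e1].
have cN e1 : e1 \in E -> s ^ #|J :\ i| <= #|N e1|.
  apply: IH => [|j e2 /setD1P[_ jJ]]; [by rewrite -cJ|exact: h].
set S := [set e' in E | off c [set i] e' == off c [set i] e].
apply: leq_trans (_ : \sum_(e1 in S) #|N e1| <= _).
  apply: leq_trans (_ : #|S| * s ^ #|J :\ i| <= _).
    by rewrite cJ expnS leq_mul2r; apply/orP; right; apply: h.
  by rewrite -sum_nat_const; apply: leq_sum => e1; rewrite inE => /andP[/cN].
(* An edge x lies in [N e1] for at most one [e1] of [S]: [e1] agrees with x in colour i and with [e]
   in all other colours. *)
have disj : forall x, \sum_(e1 in S) (x \in N e1)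
    <= (x \in [set e' in E | off c J e' == off c J e]).
  move=> x; have [/exists_inP[e1 e1S xe1]|] := boolP [exists e1 in S, x \in N e1].
    rewrite (bigD1 e1) //= xe1 big1 ?addn0 => [|e2 /andP[e2S ne]].
      move: xe1 e1S; rewrite !inE => /andP[-> /eqP/off_eqP h1] /andP[_ /eqP/off_eqP h2].
      suff -> : off c J x = off c J e by rewrite eqxx.
      apply/off_eqP => v vJ; rewrite h1 ?h2 ?inE ?(negbTE vJ) ?andbF //.
      by apply: contra vJ => /eqP ->.
    apply/eqP; rewrite eqb0; apply: contra ne => xe2; apply/eqP.
    move: xe1 e1S xe2 e2S; rewrite !inE.
    move=> /andP[_ /eqP/off_eqP h1] /andP[_ /eqP/off_eqP k1].
    move=> /andP[_ /eqP/off_eqP h2] /andP[_ /eqP/off_eqP k2].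
    apply/setP => v; have [cv|cv] := eqVneq (c v) i.
      by rewrite -h1 ?h2 // !inE cv eqxx.
    by rewrite k1 ?k2 // inE.
  rewrite negb_exists_in => /forall_inP no.
  by rewrite big1 // => e1 e1S; rewrite (negbTE (no _ e1S)).
rewrite -sum1_card [X in _ <= X]big_mkcond /=.
rewrite (eq_bigr (fun e1 => \sum_x (x \in N e1 : nat))) => [|e1 _].
  rewrite exchange_big /=; apply: leq_sum => x _.
  by apply: leq_trans (disj x) _; case: (_ \in _).
by rewrite -sum1_card big_mkcond /=; apply: eq_bigr => x _; case: (_ \in _).
Qed.

Lemma card_bigcup_leq {I T : finType} (P : pred I) (F : I -> {set T}) :
  #|\bigcup_(i | P i) F i| <= \sum_(i | P i) #|F i|.
Proof.
elim/big_rec2: _ => [|i A n _ h]; first by rewrite cards0.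
by apply: leq_trans (leq_card_setU _ _) _; rewrite leq_add2l.
Qed.

Lemma fibres_card_leq {A B : finType} (phi : A -> B) (E G : {set A}) (t : nat) :
  (forall e, e \in G -> t <= #|[set e' in E | phi e' == phi e]|) ->
  t * #|phi @: G| <= #|E|.
Proof.
move=> h; rewrite mulnC -sum_nat_const.
apply: leq_trans (_ : \sum_(b in phi @: G) #|[set e' in E | phi e' == b]| <= _).
  by apply: leq_sum => b /imsetP[e eG ->]; apply: h.
rewrite -[X in _ <= X]sum1_card (partition_big phi predT) //=.
rewrite [X in X <= _]big_mkcond /=; apply: leq_sum => b _; case: ifP => // _.
by rewrite -sum1_card; apply/eq_leq/eq_bigl => e; rewrite inE.
Qed.

(* If almost every edge had large codegree in all colours but one, pruning and
   [codegree_growth] would produce a vertex of degree at least [s ^ r.-1]. *)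
Lemma sparse_colour_pair {V : finType} {r : nat} (c : V -> 'I_r)
    (E : {set {set V}}) (s : nat) :
  1 < r -> {in E, forall e, rainbow c e} ->
  (forall v, #|[set e in E | v \in e]| < s ^ r.-1) ->
  exists i j (E' : {set {set V}}),
    [/\ i != j, E' \subset E, #|E| <= 2 * r ^ 2 * #|E'| &
        {in E', forall e, codegree c E' i e <= 2 * r ^ 2 * s
                       /\ codegree c E' j e <= 2 * r ^ 2 * s}].
Proof.
move=> r1 rb deg; set t := 2 * r ^ 2 * s.
pose E2 (p : 'I_r * 'I_r) :=
  [set e in E | (codegree c E p.1 e <= t) && (codegree c E p.2 e <= t)].
have sE2 p : E2 p \subset E by apply/subsetP => e; rewrite inE => /andP[].
have mono i p e : codegree c (E2 p) i e <= codegree c E i e.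
  apply/subset_leq_card/subsetP => e'; rewrite [in X in X -> _]inE => /andP[h1 h2].
  by rewrite inE h2 (subsetP (sE2 p)).
have [/existsP[p /andP[p12 big]]|] :=
    boolP [exists p, (p.1 != p.2) && (#|E| <= 2 * r ^ 2 * #|E2 p|)].
  exists p.1, p.2, (E2 p); split=> // e; rewrite inE => /and3P[_ h1 h2].
  by split; apply: leq_trans (mono _ _ _) _.
rewrite negb_exists => /forallP small; exfalso.
pose G j := [set e in E | [forall (i | i != j), t < codegree c E i e]].
have sG j : G j \subset E by apply/subsetP => e; rewrite inE => /andP[].
(* Large codegrees make each image of [G j] at most |E|/t in size, so a larger [G j] would survive
   pruning at threshold [s]; then s^(r-1) edges would pass through one vertex of colour j. *)
have cG j : 2 * r ^ 2 * #|G j| <= r.-1 * #|E|.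
  have cJ : #|~: [set j]| = r.-1 by rewrite cardsC1 card_ord.
  apply: leq_trans (_ : \sum_(i in ~: [set j]) t * #|off c [set i] @: G j| <= _).
    rewrite -[X in X <= _](mul1n _); under eq_bigr do rewrite /t -mulnA.
    rewrite -big_distrr /= mul1n leq_mul2l; apply/orP; right.
    rewrite leqNgt; apply/negP => /prune_small_fibres[G' [sG' /set0Pn[e eG'] hG']].
    have eE : e \in E by apply: (subsetP (sG j)); apply: (subsetP sG').
    have [v ve cv] := rainbow_ex j (rb _ eE).
    have := codegree_growth c G' s (~: [set j]) hG' e eG'; rewrite cJ leqNgt => /negP[].
    apply: leq_ltn_trans (deg v); apply/subset_leq_card/subsetP => e'.
    rewrite !inE => /andP[e'G' /eqP/off_eqP h].
    rewrite (subsetP (sG j)) ?(subsetP sG') //= h //.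
    by rewrite !inE cv eqxx.
  rewrite -cJ -sum_nat_const; apply: leq_sum => i; rewrite !inE => ij.
  apply: fibres_card_leq => e; rewrite inE => /andP[_ /forall_inP h].
  exact/ltnW/h.
have cover : E \subset (\bigcup_(p | p.1 != p.2) E2 p) :|: \bigcup_j G j.
  apply/subsetP => e eE; rewrite inE; apply/orP.
  have [/existsP[j hj]|] := boolP [exists j, e \in G j].
    by right; apply/bigcupP; exists j.
  rewrite negb_exists => /forallP noG; left.
  have pickG j : exists2 i, i != j & codegree c E i e <= t.
    have := noG j; rewrite inE eE /= negb_forall_in => /exists_inP[i ij].
    by rewrite -leqNgt; exists i.
  have r0 : 0 < r by apply: ltnW.
  (* Excluding an arbitrary colour yields one colour of small codegree; excluding that one yields a
     second. *)
  have [i _ hi] := pickG (Ordinal r0); have [j ji hj] := pickG i.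
  by apply/bigcupP; exists (j, i) => //; rewrite inE eE hi hj.
have E0 : 0 < #|E|.
  have := small (Ordinal (ltnW r1), Ordinal r1); rewrite /= -ltnNge.
  exact: leq_ltn_trans.
have := leq_trans (subset_leq_card cover) (leq_card_setU _ _).
move/leq_trans/(_ (leq_add (card_bigcup_leq _ _) (card_bigcup_leq _ _))).
move/(leq_mul (leqnn (2 * r ^ 2))); rewrite mulnDr !big_distrr /= leqNgt => /negP[].
(* After scaling by 2r^2, each of the r^2 pairs contributes at most |E| and each [G j] at most
   (r-1)|E|, in total less than 2r^2 |E|. *)
apply: leq_ltn_trans (_ : r ^ 2 * #|E| + r * (r.-1 * #|E|) < _); last first.
  rewrite -mulnn; move: #|E| E0 => m m0; case: (r) r1 => // k k1 /=.
  have : 0 < k.+1 * m by rewrite muln_gt0.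
  lia.
apply: leq_add; last first.
  rewrite -[X in _ <= X * _](card_ord r) -sum_nat_const.
  by apply: leq_sum => j _; apply: cG.
apply: leq_trans (_ : \sum_(p : 'I_r * 'I_r) #|E| <= _); last first.
  by rewrite sum_nat_const card_prod card_ord mulnn.
rewrite big_mkcond; apply: leq_sum => p _; case: ifP => // p12.
by have := small p; rewrite p12 -ltnNge => /ltnW.
Qed.

(** Here [phi e] plays the edge without one vertex and [x e] that vertex. A random label of [x e]
    lies in [N e] and avoids the fewer than t other labels of its fibre with probability at least n
    / (2|T|). *)
Lemma separating_labels {V T A B : finType} (E : {set A}) (phi : A -> B)
    (x : A -> V) (N : A -> {set T}) (n t : nat) :
  0 < #|T| -> 2 * t <= #|T| ->
  {in E &, forall e e', phi e = phi e' -> x e = x e' -> e = e'} ->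
  {in E, forall e, #|[set e' in E | phi e' == phi e]| <= t} ->
  {in E, forall e, #|N e| = n} ->
  exists psi : V -> T, n * #|E| <= 2 * #|T| * #|[set e in E |
    (psi (x e) \in N e) &&
    [forall e' in E, (phi e' == phi e) && (e' != e) ==> (psi (x e') != psi (x e))]]|.
Proof.
move=> T0 tT inj fib cN.
have [||psi] := @averaging {ffun V -> T} _ E (fun psi e => (psi (x e) \in N e) &&
    [forall e' in E, (phi e' == phi e) && (e' != e) ==> (psi (x e') != psi (x e))])
    n (2 * #|T|).
- by rewrite card_ffun expn_gt0 T0.
- move=> e eE; rewrite -(cN e eE).
  pose D := x @: [set e' in E | (phi e' == phi e) && (e' != e)].
  apply: leq_trans (_ : _ <= 2 * #|T| * #|[set f : {ffun V -> T} |
      (f (x e) \in N e) && [forall y in D, f y != f (x e)]]|) _.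
    apply: card_labellings.
      apply/imsetP => -[e']; rewrite inE => /and3P[e'E /eqP h ne] xe.
      by case/eqP: ne; apply: inj.
    apply: leq_trans tT; rewrite leq_mul2l /=; apply: leq_trans (leq_imset_card _ _) _.
    apply: leq_trans (fib e eE); apply/subset_leq_card/subsetP => e'.
    by rewrite !inE => /and3P[-> ->].
  rewrite leq_mul2l; apply/orP; right; apply/subset_leq_card/subsetP => f.
  rewrite !inE => /andP[-> /forall_inP h] /=; apply/forall_inP => e' e'E.
  by apply/implyP => h'; apply: h; apply: imset_f; rewrite inE e'E.
- by exists psi.
Qed.

(** * Tight cycles and closed walks *)

(** The walk p 0, u 0, p 1, u 1, ... closes after 2a steps. The inequalities forbid backtracking,
    also where the walk closes, because [p a = p 0] and [u a = u 0]. *)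
Definition closed_walk {T : eqType} (adj : T -> T -> bool) (a : nat) (p u : nat -> T) : Prop :=
  [/\ p a = p 0, u a = u 0,
      forall m, adj (p m) (u m) /\ adj (p m.+1) (u m) &
      forall m, p m != p m.+1 /\ u m != u m.+1].

(* Along a tight cycle of rainbow edges the colours are [r]-periodic, so the
   vertices of colours [i] and [j] alternate, and consecutive ones share an edge.
   Two successive vertices of the same colour lie in edges that differ only there. *)
Lemma tight_cycle_closed_walk {V : finType} {T : eqType} {r k l : nat}
    (c : V -> 'I_r) (i j : 'I_r) (E : {set {set V}}) (adj : T -> T -> bool)
    (chi psi : V -> T) :
  i != j -> r < k <= l * r ->
  {in E, forall e, rainbow c e} ->
  {in E, forall e : {set V}, {in e &, forall v w,
    c v = i -> c w = j -> adj (chi v) (psi w)}} ->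
  {in E &, forall e e' : {set V}, off c [set i] e = off c [set i] e' -> e != e' ->
    forall v w, v \in e -> w \in e' -> c v = i -> c w = i -> chi v != chi w} ->
  {in E &, forall e e' : {set V}, off c [set j] e = off c [set j] e' -> e != e' ->
    forall v w, v \in e -> w \in e' -> c v = j -> c w = j -> psi v != psi w} ->
  contains (Hypergraph E) (tight_cycle r k) ->
  exists2 a, 0 < a <= l & exists p u, closed_walk adj a p u.
Proof.
move=> ij /andP[rk kl] rb adjE sepi sepj /existsP[f /andP[/injectiveP f_inj /forall_inP fE]].
have r0 : 0 < r by apply: leq_ltn_trans (ltn_ord i).
have k0 : 0 < k by apply: leq_ltn_trans rk.
(* [U] unrolls the cycle into a k-periodic sequence, and [D n] is the edge starting at [U n]. *)
pose U n : V := f (Ordinal (ltn_pmod n k0)).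
pose D n : {set V} := f @: cyclic_interval r (Ordinal (ltn_pmod n k0)).
have DE n : D n \in E by apply: fE; apply: imset_f.
have DP n v : reflect (exists2 s, s < r & v = U (n + s)) (v \in D n).
  apply: (iffP imsetP) => [[x]|[s sr ->]].
    rewrite inE => /existsP[s /eqP xs] ->; exists s => //.
    by congr (f _); apply: val_inj; rewrite /= xs /= modnDml.
  exists (Ordinal (ltn_pmod (n + s) k0)) => //; rewrite inE.
  by apply/existsP; exists (Ordinal sr); rewrite /= modnDml.
have UD n s : s < r -> U (n + s) \in D n by move=> sr; apply/DP; exists s.
have UDn n : U n \in D n by rewrite -{1}[n]addn0 UD.
have Uk n : U (n + k) = U n by congr (f _); apply: val_inj; rewrite /= modnDr.
have U_neq n s : 0 < s < k -> U n != U (n + s).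
  move=> /andP[s0 sk]; apply/eqP => /f_inj/(congr1 val)/= /eqP.
  by rewrite -{1}[n]addn0 eqn_modDl mod0n modn_small // ltn_eqF.
have C_neq n s : 0 < s < r -> c (U n) != c (U (n + s)).
  move=> /andP[s0 sr]; apply/eqP => /(rainbow_inj (rb _ (DE n)) (UDn n) (UD _ _ sr)).
  by apply/eqP/U_neq; rewrite s0 (ltn_trans sr).
(* Some vertex of [D n.+1] has the colour of [U n]; all but the last lie in [D n] together with
   [U n], so it is the last. *)
have Cr n : c (U (n + r)) = c (U n).
  have [v /DP[s sr ->]] := rainbow_ex (c (U n)) (rb _ (DE n.+1)).
  have [sr'|sr' <-] := ltnP s.+1 r.
    by move=> h; have := C_neq n s.+1 sr'; rewrite -addSnnS h eqxx.
  by rewrite addSnnS (_ : s.+1 = r) //; apply/eqP; rewrite eqn_leq sr sr'.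
have Cmr n m : c (U (n + m * r)) = c (U n).
  by elim: m => [|m IH]; rewrite ?addn0 // mulSn addnCA addnC Cr.
have rdvk : r %| k.
  rewrite /dvdn; have [/eqP//|b0] := posnP (k %% r); exfalso.
  (* Otherwise, steps of length r past the end of the cycle would give [U 0] the colour of
     [U (r - k %% r)], a different vertex of the same edge. *)
  have e0 : (k %/ r).+1 * r = (r - k %% r) + k.
    by rewrite mulSn; have := ltn_pmod k r0; have := divn_eq k r; lia.
  have := C_neq 0 (r - k %% r); rewrite add0n -[U (r - _)]Uk -e0.
  rewrite -[_ * r]add0n Cmr eqxx => /(_ _)/negP; apply=> //.
  by have := ltn_pmod k r0; lia.
pose a := k %/ r.
have ak : a * r = k by apply: divnK.
have offD n : off c [set c (U n)] (D n) = off c [set c (U n)] (D n.+1).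
  apply/off_eqP => v; rewrite inE => cv; apply/DP/DP => -[s sr ev]; subst v.
    case: s sr cv => [|s] sr cv; first by rewrite addn0 eqxx in cv.
    by exists s; [apply: ltnW|rewrite addSnnS].
  have [sr'|sr'] := ltnP s.+1 r; first by exists s.+1; rewrite ?addSnnS.
  move: cv; rewrite addSnnS (_ : s.+1 = r) ?Cr ?eqxx //.
  by apply/eqP; rewrite eqn_leq sr sr'.
have D_neq n : D n != D n.+1.
  apply/eqP => e; have := UDn n; rewrite e => /DP[s sr]; rewrite addSnnS => /eqP.
  by apply/negP/U_neq; rewrite /= (leq_ltn_trans sr).
have UDr n : U (n + r) \in D n.+1.
  by rewrite -(prednK r0) -addSnnS UD // prednK.
have [vx /DP[x xr ->]] := rainbow_ex i (rb _ (DE 0)); rewrite add0n => cx.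
have [vy /DP[s sr ->] cy] := rainbow_ex j (rb _ (DE x)).
have s0 : 0 < s.
  by rewrite lt0n; apply: contra ij => /eqP s0; rewrite -cx -cy s0 addn0.
exists a; first by rewrite divn_gt0 // ltnW //= -(leq_pmul2r r0) ak.
exists (fun m => chi (U (x + m * r))), (fun m => psi (U (x + s + m * r))).
split; rewrite ?ak ?mul0n ?addn0 ?Uk // => m; split.
- by apply: (adjE _ (DE (x + m * r))); rewrite ?Cmr ?UDn // addnAC UD.
- apply: (adjE _ (DE (x + s + m * r))); rewrite ?Cmr ?UDn //.
  (* The next vertex of colour i comes r - s places after the one of colour j, hence within the edge
     starting there. *)
  rewrite (_ : x + m.+1 * r = x + s + m * r + (r - s)) ?UD //.
    by rewrite ltn_subrL s0 r0.
  by rewrite mulSn; lia.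
- rewrite mulSn addnA addnAC.
  apply: (sepi _ _ (DE (x + m * r)) (DE (x + m * r).+1)); rewrite ?Cr ?Cmr //.
  by rewrite -{1 2}cx -[c (U x)](Cmr x m) offD.
- rewrite mulSn addnA [x + s + r + _]addnAC.
  apply: (sepj _ _ (DE (x + s + m * r)) (DE (x + s + m * r).+1)); rewrite ?Cr ?Cmr //.
  by rewrite -{1 2}cy -[c (U (x + s))](Cmr (x + s) m) offD.
Qed.

(** * The relative bound from a bipartite graph of large girth *)

(** The constant multiplies the losses: r^r for the colouring, 2r^2 for the colour pair, 2 for the
    labels of colour i, and 2q^(l-1) for those of colour j, where q of the q^l labels are
    allowed. *)
Lemma relative_turan_bound {T : finType} (adj : T -> T -> bool) (r l q s : nat)
    (H : hypergraph) :
  1 < r -> 0 < l -> 0 < q -> #|T| = q ^ l ->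
  (forall p, #|[set u | adj p u]| = q) ->
  (forall a p u, 0 < a <= l -> ~ closed_walk adj a p u) ->
  is_uniform r H -> 0 < max_degree H < s ^ r.-1 -> 2 * (2 * r ^ 2 * s) <= q ^ l ->
  #|edges H| <= r ^ r * (2 * r ^ 2) * 4 * q ^ l.-1
                * ex_num H (tight_cycles_upto r (l * r)).
Proof.
move=> r1 l0 q0 cT reg girth /forall_inP uH /andP[deg0 degs] sq.
case: (pickP (fun _ : H => true)) => [v0 _|none]; last first.
  by move: deg0; rewrite /max_degree big_pred0.
have [||c hc] := @rainbow_colouring H r (edges H); first exact: ltnW.
  by move=> e /uH/eqP.
set E1 := [set e in edges H | rainbow c e] in hc.
have rb1 : {in E1, forall e, rainbow c e} by move=> e; rewrite inE => /andP[].
have [|i [j [E2 [ij sE2 h12 cod]]]] := sparse_colour_pair c E1 s r1 rb1.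
  move=> v; apply: leq_ltn_trans degs; apply: leq_trans (leq_bigmax v).
  by apply/subset_leq_card/subsetP => e; rewrite !inE => /andP[/andP[-> _] ->].
have rb2 : {in E2, forall e, rainbow c e} by move=> e /(subsetP sE2)/rb1.
(* On rainbow edges the default [v0] is never taken. *)
pose x k (e : {set H}) := odflt v0 [pick v in e | c v == k].
have xP k e : rainbow c e -> x k e \in e /\ c (x k e) = k.
  move=> rbe; rewrite /x; case: pickP => [v /andP[ve /eqP]//|/=].
  by have [v ve /eqP cv] := rainbow_ex k rbe => /(_ v); rewrite ve cv.
have xE k e v : rainbow c e -> v \in e -> c v = k -> v = x k e.
  move=> rbe ve cv; have [xe cx] := xP k e rbe.
  by apply: (rainbow_inj rbe); rewrite ?cx.
have x_inj k : {in E2 &, forall e e' : {set H},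
    off c [set k] e = off c [set k] e' -> x k e = x k e' -> e = e'}.
  move=> e e' eE e'E /off_eqP h xx; apply/setP => v.
  have [cv|cv] := eqVneq (c v) k; last by rewrite h // inE.
  have [xe cx] := xP k e (rb2 e eE); have [xe' cx'] := xP k e' (rb2 e' e'E).
  apply/idP/idP => ve; first by rewrite (xE k e v (rb2 e eE) ve cv) xx.
  by rewrite (xE k e' v (rb2 e' e'E) ve cv) -xx.
have T0 : 0 < #|T| by rewrite cT expn_gt0 q0.
have T2 : 2 * (2 * r ^ 2 * s) <= #|T| by rewrite cT.
(* Labels of colour i only have to separate; those of colour j must also be adjacent to the label
   already chosen on the edge. *)
have [||chi hchi] := separating_labels E2 (off c [set i]) (x i) (fun=> [set: T])
    #|T| _ T0 T2 (x_inj i).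
- by move=> e /cod[].
- by move=> e _; rewrite cardsT.
set E2' := [set e in E2 | _] in hchi.
have sE2' : E2' \subset E2 by apply/subsetP => e; rewrite inE => /andP[].
have [|||psi hpsi] := separating_labels E2' (off c [set j]) (x j)
    (fun e => [set u | adj (chi (x i e)) u]) q _ T0 T2.
- by move=> e e' /(subsetP sE2') eE /(subsetP sE2') e'E; apply: x_inj.
- move=> e /(subsetP sE2') eE; apply: leq_trans (proj2 (cod e eE)).
  apply/subset_leq_card/subsetP => e'; rewrite !inE => /andP[/andP[-> _]].
  by [].
- by move=> e _; apply: reg.
set E3 := [set e in E2' | _] in hpsi.
have sE3 : E3 \subset E2' by apply/subsetP => e; rewrite inE => /andP[].
have rb3 : {in E3, forall e, rainbow c e}.
  by move=> e /(subsetP sE3)/(subsetP sE2')/rb2.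
have av : avoids (Hypergraph E3) (tight_cycles_upto r (l * r)).
  rewrite /avoids all_map; apply/allP => k; rewrite mem_index_iota ltnS => hk /=.
  apply/negP => /(tight_cycle_closed_walk c i j E3 adj chi psi ij hk rb3).
  case=> [|||a ha [p [u pu]]]; last exact: girth pu.
  - move=> e eE v w ve we cv cw.
    rewrite (xE i e v (rb3 e eE) ve cv) (xE j e w (rb3 e eE) we cw).
    by move: eE; rewrite inE => /and3P[_]; rewrite inE.
  - move=> e e' eE e'E off_e ne v w ve we cv cw.
    rewrite (xE i e v (rb3 e eE) ve cv) (xE i e' w (rb3 e' e'E) we cw) eq_sym.
    move/(subsetP sE3): eE; rewrite inE => /and3P[_ _ /forall_inP h].
    move/implyP: (h e' (subsetP sE2' _ (subsetP sE3 _ e'E))); apply.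
    by rewrite off_e eqxx eq_sym.
  - move=> e e' eE e'E off_e ne v w ve we cv cw.
    rewrite (xE j e v (rb3 e eE) ve cv) (xE j e' w (rb3 e' e'E) we cw) eq_sym.
    move: eE; rewrite inE => /and3P[_ _ /forall_inP h].
    move/implyP: (h e' (subsetP sE3 _ e'E)); apply.
    by rewrite off_e eqxx eq_sym.
have sH : E3 \subset edges H.
  apply: subset_trans sE3 (subset_trans sE2' (subset_trans sE2 _)).
  by apply/subsetP => e; rewrite inE => /andP[].
have ex3 : #|E3| <= ex_num H (tight_cycles_upto r (l * r)).
  by rewrite /ex_num (bigmax_sup E3) // sH av.
have h2 : #|E2| <= 2 * #|E2'|.
  by rewrite -(leq_pmul2l T0) mulnCA mulnA.
have h3 : #|E2'| <= 2 * q ^ l.-1 * #|E3|.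
  by rewrite -(leq_pmul2l q0) mulnA mulnCA -expnS prednK // -cT.
have h23 : #|E2| <= 4 * q ^ l.-1 * ex_num H (tight_cycles_upto r (l * r)).
  apply: leq_trans h2 _; rewrite (_ : 4 = 2 * 2) // -!mulnA leq_mul2l /=.
  by apply: leq_trans h3 _; rewrite -mulnA !leq_mul2l ex3 !orbT.
rewrite -!mulnA; apply: leq_trans hc _; rewrite leq_mul2l; apply/orP; right.
apply: leq_trans h12 _; rewrite -!mulnA !leq_mul2l /=; apply/orP; right.
by rewrite mulnA h23 orbT.
Qed.

(** Both choices are minimal: s^(r-1) > D gives s^(r-1) <= 2^(r-1) D, and 3^(kl) >= 4r^2 s gives
    3^(kl) <= 3^l 4r^2 s. Raising the latter to the power (r-1)(l-1) yields the last bound. *)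
Lemma field_size_choice (r l D : nat) : 1 < r -> 0 < l -> 0 < D ->
  exists s k, [/\ D < s ^ r.-1, 0 < k, 2 * (2 * r ^ 2 * s) <= (3 ^ k) ^ l &
    ((3 ^ k) ^ l.-1) ^ (l * r.-1)
      <= (2 * (3 ^ l * (4 * r ^ 2))) ^ (r.-1 * l.-1) * D ^ l.-1].
Proof.
move=> r1 l0 D0; have r10 : 0 < r.-1 by lia.
have exs : exists s, D < s ^ r.-1.
  exists D.+1; apply: leq_trans (_ : D.+1 ^ 1 <= _); first by rewrite expn1.
  by rewrite leq_exp2l.
case: (ex_minnP exs) => s sD smin.
have s1 : 1 < s.
  case: s sD {smin} => [|[|s]] //; first by rewrite exp0n.
  by rewrite exp1n ltnS leqNgt D0.
have sD' : s ^ r.-1 <= 2 ^ r.-1 * D.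
  apply: leq_trans (_ : (2 * s.-1) ^ r.-1 <= _); first by rewrite leq_exp2r //; lia.
  rewrite expnMn leq_mul2l; apply/orP; right; rewrite leqNgt; apply/negP => /smin.
  lia.
have exk : exists k, 4 * r ^ 2 * s <= (3 ^ k) ^ l.
  exists (4 * r ^ 2 * s); rewrite -expnM.
  apply: leq_trans (ltnW (ltn_expl (4 * r ^ 2 * s) (isT : 1 < 3))) _.
  by rewrite leq_exp2l // leq_pmulr.
case: (ex_minnP exk) => k hk kmin.
have k0 : 0 < k.
  case: k hk {kmin} => //; rewrite expn0 exp1n => h.
  have : 0 < r ^ 2 * s by rewrite muln_gt0 expn_gt0; lia.
  by move: h; rewrite -mulnA; lia.
have hk' : (3 ^ k) ^ l <= 3 ^ l * (4 * r ^ 2) * s.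
  rewrite -(prednK k0) expnS expnMn -mulnA leq_mul2l; apply/orP; right.
  by rewrite leqNgt; apply/negP => /ltnW/kmin; lia.
exists s, k; split=> //; first by apply: leq_trans hk; lia.
rewrite -expnM (_ : l.-1 * (l * r.-1) = l * (r.-1 * l.-1)); last by lia.
rewrite expnM; apply: leq_trans (_ : (3 ^ l * (4 * r ^ 2) * s) ^ (r.-1 * l.-1) <= _).
  by case: (posnP (r.-1 * l.-1)) => [->//|h]; rewrite leq_exp2r.
rewrite !expnM -expnMn.
case: (posnP l.-1) => [->//|h]; rewrite leq_exp2r //.
move: (3 ^ l * _) => C.
by rewrite !expnMn [2 ^ _ * _]mulnC -mulnA leq_mul2l sD' orbT.
Qed.

(** * Affine generalized polygons in characteristic 3 *)

Import GRing.Theory.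
Local Open Scope ring_scope.

(** The first one, two or four monomials serve the generalized triangle, quadrangle and hexagon, for
    l = 2, 3, 5. *)
Definition hexagon_monomial {F : fieldType} (k : nat) (x y : F) : F :=
  nth 0 [:: x * y; x ^+ 2 * y; x ^+ 3 * y; x ^+ 3 * y ^+ 2] k.

Lemma no_closed_walk2 {F : fieldType} (x0 x1 y0 y1 : F) :
  x0 != x1 -> y0 != y1 ->
  (x1 - x0) * y0 + (x0 - x1) * y1 = 0 -> False.
Proof.
move=> hx hy e; have : (x1 - x0) * (y0 - y1) = 0 by rewrite -e; ring.
by move/eqP; rewrite mulf_eq0 !subr_eq0 (negbTE hy) eq_sym (negbTE hx).
Qed.

(** Summation by parts turns the equations into: the cyclic sum of f(x_m) (y_(m-1) - y_m) vanishes
    for every polynomial f of degree at most 2. Taking f with roots x1 and x2 leaves one term. *)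
Lemma no_closed_walk3 {F : fieldType} (x0 x1 x2 y0 y1 y2 : F) :
  x0 != x1 -> x2 != x0 -> y2 != y0 ->
  (x1 - x0) * y0 + (x2 - x1) * y1 + (x0 - x2) * y2 = 0 ->
  (x1 ^+ 2 - x0 ^+ 2) * y0 + (x2 ^+ 2 - x1 ^+ 2) * y1
    + (x0 ^+ 2 - x2 ^+ 2) * y2 = 0 -> False.
Proof.
move=> h01 h20 hy e1 e2.
have : (y2 - y0) * (x0 - x1) * (x2 - x0) = 0.
  rewrite -[RHS](mulr0 (x1 + x2)) -[in RHS]e1 -[RHS]subr0 -[in RHS]e2; ring.
move/eqP; rewrite !mulf_eq0 !subr_eq0.
by rewrite (negbTE hy) (negbTE h01) (negbTE h20).
Qed.

(** Cubics f with three of the x's as roots force x0 = x2 and x1 = x3. Then the alternating sums of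
    the y's and of their squares vanish, the latter because cubing is additive, and this forces y0 =
    y1 or y1 = y2. *)
Lemma no_closed_walk4 {F : fieldType} (x0 x1 x2 x3 y0 y1 y2 y3 : F) :
  (3%:R = 0 :> F) ->
  x0 != x1 -> x1 != x2 -> x2 != x3 -> x3 != x0 ->
  y0 != y1 -> y1 != y2 -> y2 != y3 -> y3 != y0 ->
  (forall k, (0 < k < 4)%N ->
    (x1 ^+ k - x0 ^+ k) * y0 + (x2 ^+ k - x1 ^+ k) * y1
    + (x3 ^+ k - x2 ^+ k) * y2 + (x0 ^+ k - x3 ^+ k) * y3 = 0) ->
  (x1 ^+ 3 - x0 ^+ 3) * y0 ^+ 2 + (x2 ^+ 3 - x1 ^+ 3) * y1 ^+ 2
    + (x3 ^+ 3 - x2 ^+ 3) * y2 ^+ 2 + (x0 ^+ 3 - x3 ^+ 3) * y3 ^+ 2 = 0 -> False.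
Proof.
move=> c3 h01 h12 h23 h30 k01 k12 k23 k30 e f.
have e1 := e 1%N isT; have e2 := e 2%N isT; have e3 := e 3%N isT.
have e02 : x0 = x2.
  apply/eqP; apply: contraT => h02.
  have : (y3 - y0) * (x0 - x1) * (x0 - x2) * (x0 - x3) = 0.
    rewrite -[RHS](mulr0 (x1 * x2 + x2 * x3 + x1 * x3)) -[in RHS]e1.
    rewrite -[RHS]subr0 -[in RHS](mulr0 (x1 + x2 + x3)) -[in RHS]e2.
    rewrite -[RHS]addr0 -[in RHS]e3; ring.
  move/eqP; rewrite !mulf_eq0 !subr_eq0.
  by rewrite (negbTE k30) (negbTE h01) (negbTE h02) eq_sym (negbTE h30).
have e13 : x1 = x3.
  apply/eqP; apply: contraT => h13.
  have : (y0 - y1) * (x1 - x2) * (x1 - x3) * (x1 - x0) = 0.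
    rewrite -[RHS](mulr0 (x0 * x2 + x2 * x3 + x0 * x3)) -[in RHS]e1.
    rewrite -[RHS]subr0 -[in RHS](mulr0 (x0 + x2 + x3)) -[in RHS]e2.
    rewrite -[RHS]addr0 -[in RHS]e3; ring.
  move/eqP; rewrite !mulf_eq0 !subr_eq0.
  by rewrite (negbTE k01) (negbTE h12) (negbTE h13) eq_sym (negbTE h01).
subst x2 x3.
have cube : x1 ^+ 3 - x0 ^+ 3 = (x1 - x0) ^+ 3.
  rewrite -[LHS]addr0 -[in LHS](mul0r (x1 * x0 ^+ 2 - x1 ^+ 2 * x0)) -[in LHS]c3.
  ring.
have h10 : x1 - x0 != 0 by rewrite subr_eq0 eq_sym.
have E1 : y0 - y1 + y2 - y3 = 0.
  by apply: (mulfI h10); rewrite mulr0 -e1; ring.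
have E2 : y0 ^+ 2 - y1 ^+ 2 + y2 ^+ 2 - y3 ^+ 2 = 0.
  have h10' : x1 ^+ 3 - x0 ^+ 3 != 0 by rewrite cube expf_neq0.
  by apply: (mulfI h10'); rewrite mulr0 -f; ring.
have Ey : y3 = y0 - y1 + y2 by apply/eqP; rewrite eq_sym -subr_eq0 E1.
have : (y0 - y1) * (y1 - y2) = 0.
  have -> : (y0 - y1) * (y1 - y2) = 3%:R * ((y0 - y1) * (y1 - y2))
      - (y0 ^+ 2 - y1 ^+ 2 + y2 ^+ 2 - y3 ^+ 2) by rewrite Ey; ring.
  by rewrite c3 E2 mul0r subr0.
by move/eqP; rewrite !mulf_eq0 !subr_eq0 (negbTE k01) (negbTE k12).
Qed.

(* The quintic moment equations, after five distinct values [x0..x4] have been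
   reduced to the four successive differences [A B C E], and the [y]'s to the
   partial sums [F1 F2 F3] of [(x_(m+1) - x_m) * (y_m - y_0)]. *)
Lemma hexagon_quadratic_form {F : fieldType} (A B C E F1 F2 F3 : F) :
  (3%:R = 0 :> F) ->
  A + B + C + E != 0 -> A + B != 0 -> B + C != 0 -> C + E != 0 ->
  A + B + C != 0 -> B + C + E != 0 ->
  F1 * (A + B) + F2 * (B + C) + F3 * (C + E) = 0 ->
  F1 * (B ^+ 2 - A ^+ 2) + F2 * (C ^+ 2 - B ^+ 2) + F3 * (E ^+ 2 - C ^+ 2) = 0 ->
  (A + B) * F1 ^+ 2 - 2%:R * B * F1 * F2 + (B + C) * F2 ^+ 2
    - 2%:R * C * F2 * F3 + (C + E) * F3 ^+ 2 = 0 -> F3 = 0.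
Proof.
move=> c3 h hAB hBC hCE hABC hBCE e1 e2 e3.
pose G1 := F1 * (A + B); pose G2 := F2 * (B + C); pose G3 := F3 * (C + E).
have eG : G1 * (A + B + C) = G3 * (B + C + E).
  have -> : G1 * (A + B + C) = G3 * (B + C + E)
    + (C - B) * (F1 * (A + B) + F2 * (B + C) + F3 * (C + E))
    - (F1 * (B ^+ 2 - A ^+ 2) + F2 * (C ^+ 2 - B ^+ 2) + F3 * (E ^+ 2 - C ^+ 2))
    + 3%:R * (G1 * B - G3 * C) by rewrite /G1 /G3; ring.
  by rewrite e1 e2 c3 mulr0 mul0r subr0 !addr0.
(* The linear equations leave one free parameter [mu]; substituted into the quadratic one, it gives
   mu^2 times nonzero factors. *)
have [mu eG3] : exists mu, G3 = mu * (A + B + C).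
  by exists (G3 / (A + B + C)); rewrite divfK.
have eG1 : G1 = mu * (B + C + E).
  by apply: (mulIf hABC); rewrite eG eG3; ring.
have eG2 : G2 = mu * (B + C - A - E).
  have -> : G2 = (F1 * (A + B) + F2 * (B + C) + F3 * (C + E)) - G1 - G3.
    by rewrite /G1 /G2 /G3; ring.
  rewrite e1 eG1 eG3; apply/eqP; rewrite -subr_eq0; apply/eqP.
  transitivity (3%:R * (- mu * (B + C))); last by rewrite c3 mul0r.
  by ring.
(* [3 * Q] is the difference of the two integral polynomials equated in [key]. *)
pose Q := A ^+ 3 * C + B * E ^+ 3
  - A ^+ 2 * (C * E + C ^+ 2 + 2%:R * (B * E))
  - A * (B ^+ 2 * C + B * E ^+ 2 + C ^+ 3
         + 2%:R * (B ^+ 2 * E + B * C ^+ 2 + B * C * E + C ^+ 2 * E + C * E ^+ 2))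
  - B * C ^+ 2 * E - B ^+ 3 * C - B * C ^+ 3 - B ^+ 3 * E - B ^+ 2 * E ^+ 2
  - 2%:R * (B ^+ 2 * C * E + B ^+ 2 * C ^+ 2).
have key : mu ^+ 2 * ((A + B + C + E) ^+ 2 * (A + B + C) * (B + C + E)) = 0.
  transitivity ((A + B) * (B + C) * (C + E) *
      ((A + B) * F1 ^+ 2 - 2%:R * B * F1 * F2 + (B + C) * F2 ^+ 2
      - 2%:R * C * F2 * F3 + (C + E) * F3 ^+ 2) - 3%:R * (mu ^+ 2 * Q)).
    transitivity (G1 ^+ 2 * (B + C) * (C + E) - 2%:R * B * G1 * G2 * (C + E)
      + G2 ^+ 2 * (A + B) * (C + E) - 2%:R * C * G2 * G3 * (A + B)
      + G3 ^+ 2 * (A + B) * (B + C) - 3%:R * (mu ^+ 2 * Q)).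
      by rewrite eG1 eG2 eG3 /Q; ring.
    by rewrite /G1 /G2 /G3; ring.
  by rewrite e3 c3 mulr0 mul0r subr0.
have mu0 : mu = 0.
  apply/eqP; apply: contra_eqT key => hmu.
  by rewrite !mulf_neq0.
have : G3 = 0 by rewrite eG3 mu0 mul0r.
by move/eqP; rewrite /G3 mulf_eq0 (negbTE hCE) orbF => /eqP.
Qed.

(** If x0 = x2, at most four distinct x's occur, so a cubic vanishing at all but one value leaves a
    single nonzero term in the sum by parts; coincidences of x1 with x3 or x4 are treated apart. *)
Lemma closed_walk5_distinct {F : fieldType} (x0 x1 x2 x3 x4 y0 y1 y2 y3 y4 : F) :
  x0 != x1 -> x1 != x2 -> x2 != x3 -> x3 != x4 -> x4 != x0 ->
  y0 != y1 -> y1 != y2 -> y2 != y3 -> y3 != y4 -> y4 != y0 ->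
  (forall k, (0 < k < 4)%N ->
    (x1 ^+ k - x0 ^+ k) * y0 + (x2 ^+ k - x1 ^+ k) * y1
    + (x3 ^+ k - x2 ^+ k) * y2 + (x4 ^+ k - x3 ^+ k) * y3
    + (x0 ^+ k - x4 ^+ k) * y4 = 0) -> x0 != x2.
Proof.
move=> h01 h12 h23 h34 h40 k01 k12 k23 k34 k40 e; apply/eqP => e02; subst x2.
have cubic a b c :
    (y4 - y0) * ((x0 - a) * (x0 - b) * (x0 - c))
    + (y0 - y1) * ((x1 - a) * (x1 - b) * (x1 - c))
    + (y1 - y2) * ((x0 - a) * (x0 - b) * (x0 - c))
    + (y2 - y3) * ((x3 - a) * (x3 - b) * (x3 - c))
    + (y3 - y4) * ((x4 - a) * (x4 - b) * (x4 - c)) = 0.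
  rewrite -[RHS](mulr0 (a * b + b * c + a * c)) -[in RHS](e 1%N isT).
  rewrite -[RHS]subr0 -[in RHS](mulr0 (a + b + c)) -[in RHS](e 2%N isT).
  by rewrite -[RHS]addr0 -[in RHS](e 3%N isT); ring.
have [e13|h13] := eqVneq x1 x3.
  subst x3; have := cubic x0 x1 x1; rewrite !subrr !(mul0r, mulr0, add0r).
  move/eqP; rewrite !mulf_eq0 !subr_eq0.
  by rewrite (negbTE k34) (negbTE h40) eq_sym (negbTE h34).
have [e14|h14] := eqVneq x1 x4.
  subst x4; have := cubic x0 x1 x1; rewrite !subrr !(mul0r, mulr0, add0r, addr0).
  move/eqP; rewrite !mulf_eq0 !subr_eq0.
  by rewrite (negbTE k23) (negbTE h34) eq_sym (negbTE h23).
have := cubic x0 x3 x4; rewrite !subrr !(mul0r, mulr0, add0r, addr0).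
move/eqP; rewrite !mulf_eq0 !subr_eq0.
by rewrite (negbTE k01) (negbTE h13) (negbTE h14) eq_sym (negbTE h01).
Qed.

(** By rotation all five x's are distinct. Additivity of cubes expresses the equations through the
    differences of the x's, and subtracting y0 from the y's removes one term. The quadratic form
    then gives f4 = 0, against x4 != x0 and y4 != y0. *)
Lemma no_closed_walk5 {F : fieldType} (x0 x1 x2 x3 x4 y0 y1 y2 y3 y4 : F) :
  (3%:R = 0 :> F) ->
  x0 != x1 -> x1 != x2 -> x2 != x3 -> x3 != x4 -> x4 != x0 ->
  y0 != y1 -> y1 != y2 -> y2 != y3 -> y3 != y4 -> y4 != y0 ->
  (forall k, (0 < k < 4)%N ->
    (x1 ^+ k - x0 ^+ k) * y0 + (x2 ^+ k - x1 ^+ k) * y1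
    + (x3 ^+ k - x2 ^+ k) * y2 + (x4 ^+ k - x3 ^+ k) * y3
    + (x0 ^+ k - x4 ^+ k) * y4 = 0) ->
  (x1 ^+ 3 - x0 ^+ 3) * y0 ^+ 2 + (x2 ^+ 3 - x1 ^+ 3) * y1 ^+ 2
    + (x3 ^+ 3 - x2 ^+ 3) * y2 ^+ 2 + (x4 ^+ 3 - x3 ^+ 3) * y3 ^+ 2
    + (x0 ^+ 3 - x4 ^+ 3) * y4 ^+ 2 = 0 -> False.
Proof.
move=> c3 h01 h12 h23 h34 h40 k01 k12 k23 k34 k40 e f.
have h02 : x0 != x2 by apply: closed_walk5_distinct e.
have h13 : x1 != x3.
  apply: (@closed_walk5_distinct _ x1 x2 x3 x4 x0 y1 y2 y3 y4 y0) => // k hk.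
  by rewrite -(e k hk); ring.
have h24 : x2 != x4.
  apply: (@closed_walk5_distinct _ x2 x3 x4 x0 x1 y2 y3 y4 y0 y1) => // k hk.
  by rewrite -(e k hk); ring.
have h30 : x3 != x0.
  apply: (@closed_walk5_distinct _ x3 x4 x0 x1 x2 y3 y4 y0 y1 y2) => // k hk.
  by rewrite -(e k hk); ring.
have h41 : x4 != x1.
  apply: (@closed_walk5_distinct _ x4 x0 x1 x2 x3 y4 y0 y1 y2 y3) => // k hk.
  by rewrite -(e k hk); ring.
have cube (a b : F) : b ^+ 3 - a ^+ 3 = (b - a) ^+ 3.
  transitivity ((b - a) ^+ 3 + 3%:R * (b ^+ 2 * a - b * a ^+ 2)); first by ring.
  by rewrite c3 mul0r addr0.
pose A := x2 - x1; pose B := x3 - x2; pose C := x4 - x3; pose E := x0 - x4.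
pose f1 := A * (y1 - y0); pose f2 := B * (y2 - y0).
pose f3 := C * (y3 - y0); pose f4 := E * (y4 - y0).
have s1 : f1 + f2 + f3 + f4 = 0.
  by rewrite -(e 1%N isT) /f1 /f2 /f3 /f4 /A /B /C /E; ring.
have s2 : f1 * (x1 + x2) + f2 * (x2 + x3) + f3 * (x3 + x4) + f4 * (x4 + x0) = 0.
  by rewrite -(e 2%N isT) /f1 /f2 /f3 /f4 /A /B /C /E; ring.
have s3 : f1 * A ^+ 2 + f2 * B ^+ 2 + f3 * C ^+ 2 + f4 * E ^+ 2 = 0.
  transitivity (A ^+ 3 * y1 + B ^+ 3 * y2 + C ^+ 3 * y3 + E ^+ 3 * y4
    - (A ^+ 3 + B ^+ 3 + C ^+ 3 + E ^+ 3) * y0).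
    by rewrite /f1 /f2 /f3 /f4; ring.
  by rewrite -!cube -(e 3%N isT); ring.
have s4 : A * f1 ^+ 2 + B * f2 ^+ 2 + C * f3 ^+ 2 + E * f4 ^+ 2 = 0.
  transitivity (A ^+ 3 * y1 ^+ 2 + B ^+ 3 * y2 ^+ 2 + C ^+ 3 * y3 ^+ 2
    + E ^+ 3 * y4 ^+ 2
    - 2%:R * y0 * (A ^+ 3 * y1 + B ^+ 3 * y2 + C ^+ 3 * y3 + E ^+ 3 * y4)
    + (A ^+ 3 + B ^+ 3 + C ^+ 3 + E ^+ 3) * y0 ^+ 2).
    by rewrite /f1 /f2 /f3 /f4; ring.
  have lin (u v w : F) : u = 0 -> v = 0 -> w = u - 2%:R * y0 * v -> w = 0.
    by move=> -> -> ->; rewrite mulr0 subr0.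
  by apply: (lin _ _ _ f (e 3%N isT)); rewrite -!cube; ring.
have f4E : f4 = - (f1 + f2 + f3).
  by apply/eqP; rewrite eq_sym eqr_oppLR -addr_eq0 s1.
have F30 : f1 + f2 + f3 = 0.
  apply: (@hexagon_quadratic_form _ A B C E f1 (f1 + f2)) => //.
  - by rewrite (_ : _ + _ = x0 - x1) ?subr_eq0 // /A /B /C /E; ring.
  - by rewrite (_ : _ + _ = x3 - x1) ?subr_eq0 1?eq_sym // /A /B /C /E; ring.
  - by rewrite (_ : _ + _ = x4 - x2) ?subr_eq0 1?eq_sym // /A /B /C /E; ring.
  - by rewrite (_ : _ + _ = x0 - x3) ?subr_eq0 1?eq_sym // /A /B /C /E; ring.
  - by rewrite (_ : _ + _ = x4 - x1) ?subr_eq0 // /A /B /C /E; ring.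
  - by rewrite (_ : _ + _ = x0 - x2) ?subr_eq0 // /A /B /C /E; ring.
  - by rewrite -[RHS]oppr0 -[in RHS]s2 f4E /A /B /C /E; ring.
  - by rewrite -[RHS]oppr0 -[in RHS]s3 f4E; ring.
  - by rewrite -[RHS]s4 f4E; ring.
move/eqP: f4E; rewrite F30 oppr0 mulf_eq0 !subr_eq0 (negbTE k40) orbF.
by rewrite eq_sym (negbTE h40).
Qed.

(* The incidence structure is the affine part of a generalized [l.+1]-gon:
   points and lines are [F * F^(l-1)], and the equations
   [p_k + u_k = g_k (p.1, u.1)] determine a line by its first coordinate and
   any point on it, and dually. *)
Definition incident {F : finFieldType} {l : nat} (p u : F * {ffun 'I_l -> F}) :=
  [forall k, p.2 k + u.2 k == hexagon_monomial k p.1 u.1].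

Lemma card_incident {F : finFieldType} {l : nat} (p : F * {ffun 'I_l -> F}) :
  #|[set u | incident p u]| = #|F|.
Proof.
pose f (y : F) := (y, [ffun k : 'I_l => hexagon_monomial k p.1 y - p.2 k]).
have f_inj : injective f by move=> y z [].
rewrite -cardsT -(card_imset _ f_inj); apply: eq_card => -[y v]; rewrite inE.
apply/forallP/imsetP => [h|[z _ [-> ->]] k]; last by rewrite ffunE addrC subrK.
exists y => //; congr pair; apply/ffunP => k; rewrite ffunE -(eqP (h k)) /=.
by rewrite addrC addKr.
Qed.

Lemma incident_injl {F : finFieldType} {l : nat} {p p' u : F * {ffun 'I_l -> F}} :
  incident p u -> incident p' u -> p.1 = p'.1 -> p = p'.
Proof.
move=> /forallP h /forallP h'; case: p p' h h' => [x v] [x' v'] /= h h' exx'.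
subst x'; congr pair; apply/ffunP => k; apply: (addIr (u.2 k)).
by rewrite (eqP (h k)) (eqP (h' k)).
Qed.

Lemma incident_injr {F : finFieldType} {l : nat} {p u u' : F * {ffun 'I_l -> F}} :
  incident p u -> incident p u' -> u.1 = u'.1 -> u = u'.
Proof.
move=> /forallP h /forallP h'; case: u u' h h' => [x v] [x' v'] /= h h' exx'.
subst x'; congr pair; apply/ffunP => k; apply: (addrI (p.2 k)).
by rewrite (eqP (h k)) (eqP (h' k)).
Qed.

(** Around the walk each coordinate equation telescopes to a moment equation in the first
    coordinates, and absence of backtracking makes consecutive first coordinates differ. *)
Lemma incident_girth {F : finFieldType} (l a : nat) (p u : nat -> F * {ffun 'I_l.-1 -> F}) :
  (3%:R = 0 :> F) -> l \in [:: 2; 3; 5]%N -> (0 < a <= l)%N ->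
  p a = p 0%N -> u a = u 0%N ->
  (forall m, incident (p m) (u m)) -> (forall m, incident (p m.+1) (u m)) ->
  (forall m, p m != p m.+1) -> (forall m, u m != u m.+1) -> False.
Proof.
move=> c3 hl ha pa ua inc inc' dp du.
have dx m : (p m).1 != (p m.+1).1.
  by apply: contra (dp m) => /eqP e; apply/eqP; exact: (incident_injl (inc m) (inc' m)).
have dy m : (u m).1 != (u m.+1).1.
  by apply: contra (du m) => /eqP e; apply/eqP; exact: (incident_injr (inc' m) (inc m.+1)).
have xa : (p a).1 = (p 0%N).1 by rewrite pa.
have ya : (u a).1 = (u 0%N).1 by rewrite ua.
have sums k : (k < l.-1)%N ->
    \sum_(0 <= m < a) (hexagon_monomial k (p m.+1).1 (u m).1
                       - hexagon_monomial k (p m).1 (u m).1) = 0.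
  move=> kl; transitivity (\sum_(0 <= m < a)
      ((p m.+1).2 (Ordinal kl) - (p m).2 (Ordinal kl))).
    apply: eq_bigr => m _; move/forallP/(_ (Ordinal kl))/eqP: (inc m) => /= <-.
    move/forallP/(_ (Ordinal kl))/eqP: (inc' m) => /= <-; ring.
  by rewrite telescope_sumr // pa subrr.
have e1 : (0 < l.-1)%N ->
    \sum_(0 <= m < a) (((p m.+1).1 ^+ 1 - (p m).1 ^+ 1) * (u m).1) = 0.
  by move/sums => e; rewrite -[RHS]e; apply: eq_bigr => m _; rewrite mulrBl.
have e2 : (1 < l.-1)%N ->
    \sum_(0 <= m < a) (((p m.+1).1 ^+ 2 - (p m).1 ^+ 2) * (u m).1) = 0.
  by move/sums => e; rewrite -[RHS]e; apply: eq_bigr => m _; rewrite mulrBl.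
have e3 : (2 < l.-1)%N ->
    \sum_(0 <= m < a) (((p m.+1).1 ^+ 3 - (p m).1 ^+ 3) * (u m).1) = 0.
  by move/sums => e; rewrite -[RHS]e; apply: eq_bigr => m _; rewrite mulrBl.
have e4 : (3 < l.-1)%N ->
    \sum_(0 <= m < a) (((p m.+1).1 ^+ 3 - (p m).1 ^+ 3) * (u m).1 ^+ 2) = 0.
  by move/sums => e; rewrite -[RHS]e; apply: eq_bigr => m _; rewrite mulrBl.
have hl0 : (0 < l.-1)%N by move: hl; rewrite !inE => /or3P[] /eqP ->.
move/(_ hl0): e1 => e1 {sums pa ua inc inc' dp du}.
(* With l in {2, 3, 5}, a = 3 forces l >= 3, and a = 4 or 5 forces l = 5, so the moment equations
   needed are available. *)
case: a => [|[|[|[|[|[|a]]]]]] // in ha xa ya e1 e2 e3 e4 *.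
- by have := dx 0%N; rewrite xa eqxx.
- move: e1; rewrite unlock /= addr0 xa !expr1.
  exact: no_closed_walk2 (dx 0%N) (dy 0%N).
- have hl1 : (1 < l.-1)%N by move: hl ha; rewrite !inE => /or3P[] /eqP ->.
  move: e1 (e2 hl1) (dx 0%N) (dx 2%N) (dy 2%N).
  rewrite unlock /= !addr0 xa ya !expr1 !addrA => E1 E2 ? ? ?.
  exact: no_closed_walk3 E1 E2.
- have l5 : l = 5%N by move: hl ha; rewrite !inE => /or3P[] /eqP ->.
  subst l; move: e1 (e2 isT) (e3 isT) (e4 isT) (dx 3%N) (dy 3%N).
  rewrite unlock /= !addr0 xa ya !addrA => E1 E2 E3 E4 ? ?.
  by apply: no_closed_walk4 E4 => // -[|[|[|[]]]].
- have l5 : l = 5%N by move: hl ha; rewrite !inE => /or3P[] /eqP ->.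
  subst l; move: e1 (e2 isT) (e3 isT) (e4 isT) (dx 4%N) (dy 4%N).
  rewrite unlock /= !addr0 xa ya !addrA => E1 E2 E3 E4 ? ?.
  by apply: no_closed_walk5 E4 => // -[|[|[|[]]]].
- by move: hl ha; rewrite !inE => /or3P[] /eqP ->.
Qed.

(** The loss m is q^(l-1) for a power q of 3; integer powers stand in for the exponent
    (l-1)/(l(r-1)), and [A], [B] depend on r and l only. *)
Lemma relative_turan_tight_cycles (r l : nat) :
  (1 < r)%N -> l \in [:: 2; 3; 5]%N ->
  exists A B : nat, forall H : hypergraph, is_uniform r H -> (0 < max_degree H)%N ->
    exists2 m : nat,
      (#|edges H| <= A * m * ex_num H (tight_cycles_upto r (l * r)))%N &
      (m ^ (l * r.-1) <= B * max_degree H ^ l.-1)%N.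
Proof.
move=> r1 hl; have l0 : (0 < l)%N by move: hl; rewrite !inE => /or3P[] /eqP ->.
exists (r ^ r * (2 * r ^ 2) * 4)%N, ((2 * (3 ^ l * (4 * r ^ 2))) ^ (r.-1 * l.-1))%N.
move=> H uH D0; have [s [k [sD k0 sq hm]]] := field_size_choice r l _ r1 l0 D0.
exists ((3 ^ k) ^ l.-1)%N => //.
have [F c3 cF] := @pPrimePowerField 3%N k isT k0.
apply: (@relative_turan_bound (F * {ffun 'I_l.-1 -> F})%type incident r l (3 ^ k) s) => //.
- by rewrite expn_gt0.
- by rewrite card_prod card_ffun card_ord cF -expnS prednK.
- by move=> p; rewrite card_incident.
- move=> a p u ha [pa ua adj neq].
  apply: (incident_girth l a p u _ hl ha pa ua) => [|m|m|m|m].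
  + by apply/eqP; case/andP: c3.
  + by have [] := adj m.
  + by have [] := adj m.
  + by have [] := neq m.
  + by have [] := neq m.
- by rewrite D0.
Qed.

From mathcomp Require Import all_classical all_reals all_analysis.
Import Order.TTheory Num.Theory.
Import numFieldNormedType.Exports.
Local Open Scope classical_set_scope.

(** * Asymptotics *)

Lemma cvg_div_ln_nat {R : realType} (c : R) :
  c / ln (n%:R : R) @[n --> \oo] --> (0 : R).
Proof.
apply/cvgr0Pnorm_lt => e e0.
near=> n; have big : expR (`|c| / e) < n%:R :> R by near: n; exact: nbhs_infty_gtr.
have n0 : 0 < n%:R :> R by apply: lt_trans big; exact: expR_gt0.
have lt : `|c| / e < ln (n%:R : R) by rewrite -ltr_expR lnK.
have ln0 : 0 < ln (n%:R : R) by apply: le_lt_trans lt; rewrite divr_ge0 // ltW.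
by rewrite normrM normfV (gtr0_norm ln0) ltr_pdivrMr // mulrC -ltr_pdivrMr.
Unshelve. all: by end_near.
Qed.

(** This is how a constant factor is absorbed into the o(1) of the exponent. *)
Lemma powR_div_ln {R : realType} (x c : R) :
  1 < x -> 0 < c -> x `^ (ln c / ln x) = c.
Proof.
move=> x1 c0; have lnx : 0 < ln x by exact: ln_gt0.
have x0 : 0 < x by exact: lt_trans x1.
by rewrite /powR gt_eqF // divfK ?gt_eqF // lnK.
Qed.

(** An n-th root is taken; B <= (B+1)^n lets B+1 replace the root of B. *)
Lemma natr_le_powR {R : realType} (m B D n k : nat) :
  (0 < n)%N -> (m ^ n <= B * D ^ k)%N ->
  m%:R <= B.+1%:R * D%:R `^ (k%:R / n%:R) :> R.
Proof.
move=> n0 h; rewrite -(ler_pXn2r n0) ?nnegrE ?mulr_ge0 ?powR_ge0 ?ler0n //.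
rewrite exprMn -[(_ `^ _) ^+ n]powR_mulrn ?powR_ge0 // -powRrM divfK ?pnatr_eq0 -?lt0n //.
rewrite powR_mulrn ?ler0n // -!natrX -natrM ler_nat; apply: leq_trans h _.
rewrite leq_mul2r; apply/orP; right.
apply: leq_trans (leqnSn B) _; rewrite -{1}[B.+1]expn1 leq_pexp2l //.
Qed.

Theorem theorem1p6 (R : realType) (r l : nat)
    (hr : (2 <= r)%N) (hl : l \in [:: 2%N; 3%N; 5%N]) :
  exists2 o : nat -> R, o @ \oo --> (0 : R) &
    \forall D \near \oo, forall H : hypergraph,
      is_uniform r H -> max_degree H = D ->
      (ex_num H (tight_cycles_upto r (l * r)%N))%:R >=
        D%:R `^ (- ((l%:R - 1) / (l%:R * (r%:R - 1))) - o D)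
          * #|edges H|%:R :> R.
Proof.
have [A [B hAB]] := relative_turan_tight_cycles r l hr hl.
(* The successors keep [K] positive, so that D^(ln K / ln D) = K. *)
pose K : R := A.+1%:R * B.+1%:R.
have K0 : 0 < K by rewrite mulr_gt0 ?ltr0n.
exists (fun D => ln K / ln D%:R); first exact: cvg_div_ln_nat.
near=> D => H uH HD.
have D1 : (1 < D)%N by near: D; exact: nbhs_infty_gt.
have [|m hE hm] := hAB H uH; first by rewrite HD ltnW.
have l0 : (0 < l)%N by move: hl; rewrite !inE => /or3P[] /eqP ->.
have r0 : (0 < r)%N by exact: ltnW.
rewrite HD in hm; have n0 : (0 < l * r.-1)%N by rewrite muln_gt0 l0 -subn1 subn_gt0.
have := natr_le_powR (R := R) _ _ _ _ _ n0 hm.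
have -> : l.-1%:R / (l * r.-1)%:R = (l%:R - 1) / (l%:R * (r%:R - 1)) :> R.
  by rewrite natrM -!subn1 !natrB.
set al := _ / _ => hm'.
have Dne : D%:R != 0 :> R by rewrite pnatr_eq0 -lt0n ltnW.
rewrite powRD; last by rewrite Dne implybT.
rewrite !powRN powR_div_ln ?ltr1n // -invfM mulrC ler_pdivrMr; last first.
  by rewrite mulr_gt0 // powR_gt0 // ltr0n ltnW.
set X := ex_num _ _ in hE *.
apply: le_trans (_ : (A.+1 * m * X)%:R <= _).
  by rewrite ler_nat; apply: leq_trans hE _; rewrite !leq_mul2r leqnSn !orbT.
rewrite !natrM [X in _ <= X]mulrC ler_wpM2r // /K.
by rewrite [X in _ <= X]mulrC -mulrA ler_wpM2l.
Unshelve. all: by end_near.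
Qed.
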